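(* Let $H$ be a complex Hilbert space and let $T\in B(H)$ be a selfadjoint rank one operator with $\operatorname{tr}T\neq 0$. Then $\mathcal S(T)$ is simple if and only if $\operatorname{tr}T\in\{-1,1\}$.
   Context: $H$ may be finite or infinite dimensional; $B(H)$ is the set of bounded linear operators on $H$. $\mathcal S(T)=\{T^n: n\ge1\}$ is the multiplicative semigroup generated by $T$. An ideal $J$ of a semigroup $\mathcal S\subset B(H)$ is a (two-sided) multiplicative ideal: a subset $J\subset\mathcal S$ with $XA, AX\in J$ for all $A\in J$, $X\in\mathcal S$ (no closure under sums or scalars is required). $\mathcal S$ is simple if its only nonzero ideal (i.e. ideal containing a nonzero operator) is $\mathcal S$ itself. $\operatorname{tr}$ denotes the trace. *)

(* Defs.v *)
From mathcomp Require Import all_boot all_order all_algebra finmap.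
From mathcomp Require Import complex.
From mathcomp Require Import all_classical all_reals all_analysis.
From mathcomp.analysis.showcase Require Import summability.

Set Implicit Arguments.
Unset Strict Implicit.
Unset Printing Implicit Defensive.

Import Order.TTheory GRing.Theory Num.Theory.
Import numFieldNormedType.Exports.

Local Open Scope classical_set_scope.
Local Open Scope ring_scope.
Local Open Scope complex_scope.

(** [dot] is linear in its first argument.  A complete complex normed module
    whose norm comes from [dot] in this way is a complex Hilbert space. *)
Definition norm_from_dot (R : realType) (H : completeNormedModType R[i])
    (dot : {dot H for (@Num.conj R[i])}) : Prop :=
  forall x : H, `|x| ^+ 2 = dot x x.

Definition bounded_operator (R : realType) (H : completeNormedModType R[i])
    (T : {linear H -> H}) : Prop :=
  exists M : R[i], forall x : H, `|T x| <= M * `|x|.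

Definition selfadjoint (R : realType) (H : completeNormedModType R[i])
    (dot : {dot H for (@Num.conj R[i])}) (T : H -> H) : Prop :=
  forall x y : H, dot (T x) y = dot x (T y).

Definition rank_one (R : realType) (H : completeNormedModType R[i])
    (T : H -> H) : Prop :=
  exists2 v : H, v != 0 & range T = [set a *: v | a in [set: R[i]]].

Definition orthonormal_basis (R : realType) (H : completeNormedModType R[i])
    (dot : {dot H for (@Num.conj R[i])}) (E : set H) : Prop :=
  (forall e f : H, E e -> E f -> dot e f = (e == f)%:R) /\
  (forall x : H, (forall e : H, E e -> dot x e = 0) -> x = 0).

(** The net of finite partial sums of <T e, e>, e in E, converges to [c], for
    every orthonormal basis [E] (of any cardinality); [f \_ E] is [f] extended
    by 0 outside [E]. *)
Definition has_trace (R : realType) (H : completeNormedModType R[i])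
    (dot : {dot H for (@Num.conj R[i])}) (T : H -> H) (c : R[i]) : Prop :=
  forall E : set H, orthonormal_basis dot E ->
    partial_sum ((fun e : H => dot (T e) e) \_ E) A @[A --> totally] --> (c : R[i]^o).

(** Junk value 0 when [T] has no trace. *)
Definition trace (R : realType) (H : completeNormedModType R[i])
    (dot : {dot H for (@Num.conj R[i])}) (T : H -> H) : R[i] :=
  xget 0 [set c | has_trace dot T c].

Definition generated_semigroup (X : Type) (T : X -> X) : set (X -> X) :=
  [set iter n T | n in [set n | (1 <= n)%N]].

Definition semigroup_ideal (X : Type) (S J : set (X -> X)) : Prop :=
  J `<=` S /\ (forall A B, J A -> S B -> J (B \o A) /\ J (A \o B)).

Definition simple_semigroup (X : zmodType) (S : set (X -> X)) : Prop :=
  forall J : set (X -> X), semigroup_ideal S J ->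
    (exists2 A, J A & A <> (fun=> 0)) -> J = S.

(* Main.v *)
(** Selfadjointness forces a rank one [T] to be [mu] times the orthogonal
    projection onto a line spanned by some [v], with [mu] real and nonzero, so
    that [T^(n+1) = mu^n T].  Parseval's identity for [v], in an arbitrary
    orthonormal basis, gives [tr T = mu]; since [trace] quantifies over all
    bases, its uniqueness also needs the existence of one, which is Zorn's
    lemma.  If the semigroup is simple, its ideal [{T^n : n >= 2}] contains
    [T], so [mu] is a real root of unity.  Conversely, if [mu^2 = 1] then
    [T^k = T^n T^(k+n)] lies in every ideal containing [T^n]. *)

Require Import Defs.
From mathcomp Require Import all_boot all_order all_algebra complex finmap.
From mathcomp Require Import all_classical all_reals all_analysis.
From mathcomp.analysis.showcase Require Import summability.

Import Order.TTheory GRing.Theory Num.Theory.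
Import numFieldNormedType.Exports.

Local Open Scope classical_set_scope.
Local Open Scope ring_scope.

(** Taking norms gives [|c| = 1], and a real [c] is [|c|] or [- |c|]. *)
Lemma real_unity_root (K : numDomainType) (c : K) n : c \is Num.real -> c ^+ n.+1 = 1 ->
  c = -1 \/ c = 1.
Proof.
move=> cR c1; have /eqP : `|c| ^+ n.+1 = 1 by rewrite -normrX c1 normr1.
rewrite pexpr_eq1// => /eqP nc1.
have /orP[c0|c0] := cR; [right|left]; rewrite -nc1.
  by rewrite ger0_norm.
by rewrite ler0_norm// opprK.
Qed.

Lemma big_fsetD_sub (I : choiceType) (V : zmodType) (F : I -> V)
    (A B : {fset I}) : (A `<=` B)%fset ->
  \sum_(e <- B) F e - \sum_(e <- A) F e = \sum_(e <- (B `\` A)%fset) F e.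
Proof.
move=> AB; rewrite (big_fsetID _ (mem A)) /=.
rewrite (_ : [fset e in B | e \in A]%fset = A); last first.
  apply/fsetP => e; rewrite !inE andbC.
  by case: (boolP (e \in A)) => //= /(fsubsetP AB) ->.
rewrite (_ : [fset e in B | e \notin A]%fset = (B `\` A)%fset).
  by rewrite addrAC subrr add0r.
by apply/fsetP => e; rewrite !inE andbC.
Qed.

(** * Powers of an operator satisfying [T^2 = mu T] *)

Section EigenSemigroup.
Context {K : numFieldType} {V : lmodType K}.
Variables (T : {linear V -> V}) (mu : K).
Hypothesis TT : forall x, T (T x) = mu *: T x.

Lemma iter_eigen n x : iter n.+1 T x = mu ^+ n *: T x.
Proof.
elim: n => [|n IHn]; first by rewrite expr0 scale1r.
by rewrite iterS IHn linearZ /= TT scalerA -exprSr.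
Qed.

Lemma generated_semigroup_simpleP : T <> (fun=> 0) :> (V -> V) ->
  mu != 0 -> mu \is Num.real ->
  simple_semigroup (generated_semigroup T) <-> mu = -1 \/ mu = 1.
Proof.
move=> T0 mu0 muR.
have [x Tx0] : exists x, T x != 0.
  apply/not_existsP => Tx; apply: T0; apply/funext => x.
  by apply/eqP/negPn/negP/Tx.
have addn_comp m n : iter m T \o iter n T = iter (m + n) T.
  by apply/funext => y; rewrite /= iterD.
split=> [simpleT|mu1].
  pose J := [set iter n T | n in [set n | (2 <= n)%N]].
  have JT : J = generated_semigroup T.
    apply: simpleT.
      split=> [_ [n /= n2 <-]|_ _ [m /= m2 <-] [n /= n1 <-]].
        by exists n => //=; exact: ltnW.
      rewrite !addn_comp; split; [exists (n + m)%N|exists (m + n)%N] => //=.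
        by rewrite (leq_trans m2)// leq_addl.
      by rewrite (leq_trans m2)// leq_addr.
    (* [T^2] is a nonzero member of [J], since [T^2 x = mu T x]. *)
    exists (iter 2 T); first by exists 2%N.
    move=> /(congr1 (@^~ x)) /eqP; rewrite iter_eigen expr1 scaler_eq0.
    by rewrite (negbTE mu0) (negbTE Tx0).
  (* Membership of [T] in [J] reads [T^(n+2) = T]; evaluating at [x] and cancelling [T x] leaves
     [mu^(n+1) = 1]. *)
  have [[|[|n]]//= _ Tn] : J T by rewrite JT; exists 1%N.
  apply: (@real_unity_root _ mu n muR); apply/eqP; rewrite -subr_eq0.
  have : iter n.+2 T x = T x by rewrite -[in RHS]Tn.
  rewrite iter_eigen => /eqP; rewrite -[X in _ == X]scale1r -subr_eq0 -scalerBl.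
  by rewrite scaler_eq0 (negbTE Tx0) orbF.
move=> J [JS Jideal] [A JA _]; apply/seteqP; split=> // _ [k /= k1 <-].
have [n /= n1 An] := JS _ JA.
(* The exponents add up to [k + 2n]: the excess over [k] is even, so it only contributes
   [(mu^2)^n = 1]. *)
have -> : iter k T = A \o iter (k + n) T.
  rewrite -An addn_comp; apply/funext => y.
  case: k k1 => // k _; rewrite addnC -addnA addnn addSn !iter_eigen.
  rewrite exprD -muln2 mulnC exprM.
  by case: mu1 => ->; rewrite ?sqrrN !expr1n mulr1.
by apply: (Jideal _ _ JA _).2; exists (k + n)%N => //=; rewrite addn_gt0 k1.
Qed.

End EigenSemigroup.

(** * Finite Fourier sums in an inner product space *)

Section OrthonormalFamilies.
Context {C : numClosedFieldType} {H : lmodType C}.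
Variable dot : {dot H for (@Num.conj C)}.

Lemma dotC (u v : H) : dot u v = (dot v u)^*.
Proof. by rewrite hermC mul1r. Qed.

Lemma dot_suml (I : Type) (r : seq I) (F : I -> H) (y : H) :
  dot (\sum_(i <- r) F i) y = \sum_(i <- r) dot (F i) y.
Proof.
elim: r => [|i r IHr]; first by rewrite !big_nil linear0l.
by rewrite !big_cons linearDl /= IHr.
Qed.

Lemma dot_cauchy_schwarz (u v : H) :
  `|dot u v| ^+ 2 <= dot u u * dot v v.
Proof.
have [->|v0] := eqVneq v 0.
  by rewrite !linear0r normr0 expr0n.
have vv0 : 0 < dot v v by rewrite dnorm_gt0.
have vvC : (dot v v)^* = dot v v by rewrite -dotC.
(* [a *: v] is the projection of [u] onto the line of [v]; the squared norm of the residual is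
   [dot u u - |dot u v|^2 / dot v v]. *)
pose a := dot u v / dot v v.
have : 0 <= dot (u - a *: v) (u - a *: v) by exact: dnorm_ge0.
rewrite dnormB dnormZ linearZr_LR /= /a rmorphM fmorphV /= vvC.
set p := dot u v.
rewrite normrM normfV (ger0_norm (ltW vv0)) -/p.
have -> : p^* / dot v v * p = `|p| ^+ 2 / dot v v.
  by rewrite normCK mulrAC [p^* * p]mulrC.
rewrite rmorphM fmorphV /= vvC rmorphXn /= (CrealP (normr_real _)).
have -> : (`|p| / dot v v) ^+ 2 * dot v v = `|p| ^+ 2 / dot v v.
  by rewrite expr2 -mulrA divfK ?gt_eqF// expr2 mulrAC.
rewrite opprD addrACA subrr addr0 subr_ge0.
by rewrite ler_pdivrMr.
Qed.

Variable E : set H.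
Hypothesis onE : forall e f : H, E e -> E f -> dot e f = (e == f)%:R.
Implicit Types (x : H) (A B : {fset H}).

(** Extension by 0 outside [E] lets the sums run over all finite subsets of [H], as the partial sums
    in [has_trace] do. *)
Definition fourier x : H -> C := (dot x) \_ E.

Definition fourier_sum x A : H := \sum_(e <- A) fourier x e *: e.

Definition fourier_sqr x A : C := \sum_(e <- A) `|fourier x e| ^+ 2.

Lemma fourierE x e : E e -> fourier x e = dot x e.
Proof. by move=> Ee; rewrite /fourier patchE mem_set. Qed.

Lemma fourier_out x e : ~ E e -> fourier x e = 0.
Proof. by move=> Ee; rewrite /fourier patchE memNset. Qed.

Lemma dot_fourier_sum x A f : E f -> f \in A ->
  dot (fourier_sum x A) f = dot x f.
Proof.
move=> Ef fA; rewrite dot_suml (big_fsetD1 f)//=.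
rewrite linearZl_LR /= (onE _ _ Ef Ef) eqxx.
rewrite fourierE// mulr1 big1_fset ?addr0// => e.
rewrite in_fsetD1 => /andP[ef _] _; rewrite linearZl_LR/=.
have [Ee|nEe] := pselect (E e); last by rewrite fourier_out// mul0r.
by rewrite onE// (negbTE ef) mulr0.
Qed.

Lemma dot_residual_fourier_sum x A :
  dot (x - fourier_sum x A) (fourier_sum x A) = 0.
Proof.
rewrite dotC dot_suml big_seq big1 ?rmorph0// => e eA.
rewrite linearZl_LR/=.
have [Ee|nEe] := pselect (E e); last by rewrite fourier_out// mul0r.
by rewrite dotC linearBl /= dot_fourier_sum// subrr rmorph0 mulr0.
Qed.

Lemma dnorm_fourier_sum x A :
  dot (fourier_sum x A) (fourier_sum x A) = fourier_sqr x A.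
Proof.
rewrite {1}/fourier_sum dot_suml /fourier_sqr !big_seq.
apply: eq_bigr => e eA; rewrite linearZl_LR/=.
have [Ee|nEe] := pselect (E e).
  by rewrite dotC dot_fourier_sum// fourierE// normCK.
by rewrite fourier_out// mul0r normr0 expr0n.
Qed.

(** Pythagoras: [x] is the orthogonal sum of its Fourier sum and the residual. *)
Lemma dnorm_residual x A :
  dot (x - fourier_sum x A) (x - fourier_sum x A) = dot x x - fourier_sqr x A.
Proof.
have /hnormDd := dot_residual_fourier_sum x A.
by rewrite subrK /= dnorm_fourier_sum => ->; rewrite addrK.
Qed.

Lemma bessel x A : fourier_sqr x A <= dot x x.
Proof. by rewrite -subr_ge0 -dnorm_residual dnorm_ge0. Qed.

Lemma fourier_sqr_ge0 x A : 0 <= fourier_sqr x A.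
Proof. by apply: sumr_ge0 => e _; rewrite exprn_ge0. Qed.

(** The difference is itself the Fourier sum over [B] minus [A]. This reduces the Cauchy property of
    Fourier sums to that of numerical sums. *)
Lemma dnorm_fourier_sumB x A B : (A `<=` B)%fset ->
  dot (fourier_sum x B - fourier_sum x A) (fourier_sum x B - fourier_sum x A) =
  fourier_sqr x B - fourier_sqr x A.
Proof.
by move=> AB; rewrite /fourier_sum /fourier_sqr !big_fsetD_sub// dnorm_fourier_sum.
Qed.

End OrthonormalFamilies.

Local Open Scope complex_scope.

#[local] Existing Instance totally_filter.

(** * Parseval's identity and existence of orthonormal bases *)

Section HilbertSpace.
Context {R : realType} {H : completeNormedModType R[i]}.
Variable dot : {dot H for (@Num.conj R[i])}.
Hypothesis dot_norm : norm_from_dot dot.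

Lemma norm_dot_le (x y : H) : `|dot x y| <= `|x| * `|y|.
Proof.
rewrite -(@ler_pXn2r _ 2)// ?nnegrE ?mulr_ge0// exprMn !dot_norm.
exact: dot_cauchy_schwarz.
Qed.

Lemma fourier_sqr_near_sup (E : set H) (x : H) (eps : R[i]) :
  (forall e f, E e -> E f -> dot e f = (e == f)%:R) -> 0 < eps ->
  exists A : {fset H}, forall B : {fset H}, (A `<=` B)%fset ->
    fourier_sqr dot E x B - fourier_sqr dot E x A < eps.
Proof.
move=> onE eps0.
(* The sums are nonnegative, hence real; passing to real parts gives access to suprema in [R], with
   Bessel's inequality as the bound. *)
have sR A : (complex.Re (fourier_sqr dot E x A))%:C = fourier_sqr dot E x A.
  by rewrite RRe_real// ger0_real// fourier_sqr_ge0.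
have epsR : (complex.Re eps)%:C = eps by rewrite RRe_real// gtr0_real.
pose S := range (fun A => complex.Re (fourier_sqr dot E x A)).
have supS : has_sup S.
  split; first by exists (complex.Re (fourier_sqr dot E x fset0)), fset0.
  exists (complex.Re (dot x x)) => _ [A _ <-].
  by have := bessel _ _ onE x A; rewrite lecE => /andP[].
have Reps : 0 < complex.Re eps by rewrite -ltcR epsR.
have [_ [A _ <-] SA] := sup_adherent Reps supS.
exists A => B _; rewrite -[X in X - _]sR -[X in _ - X]sR -epsR -rmorphB ltcR.
rewrite ltrBlDl; rewrite ltrBlDr in SA; apply: le_lt_trans SA.
by apply: sup_upper_bound => //; exists B.
Qed.

Lemma parseval (E : set H) (x : H) : orthonormal_basis dot E ->
  fourier_sqr dot E x A @[A --> totally] --> (dot x x : R[i]^o).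
Proof.
move=> [onE totalE].
have /cvg_ex[/= w cvgw] : cvg (fourier_sum dot E x A @[A --> totally]).
  apply: cauchy_cvg; apply: cauchy_exP => eps eps0.
  (* The tolerance is squared because differences of [fourier_sqr] are squared norms. *)
  have [|A Asup] := fourier_sqr_near_sup E x (eps ^+ 2) onE; first exact: exprn_gt0.
  exists (fourier_sum dot E x A), A => //= B /= AB.
  rewrite -ball_normE /= distrC -(@ltr_pXn2r _ 2)// ?nnegrE// ?ltW//.
  by rewrite dot_norm dnorm_fourier_sumB// Asup.
have xw : x = w.
  apply/eqP; rewrite -subr_eq0; apply/eqP; apply: totalE => e Ee.
  (* Otherwise take [|dot (x - w) e|] as the radius. A late Fourier sum whose index set contains [e]
     has the same coefficient at [e] as [x], so Cauchy-Schwarz makes this radius smaller than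
     itself. *)
  apply/eqP/negPn/negP => d0.
  have /cvgrPdist_lt /(_ `|dot (x - w) e|) := cvgw.
  rewrite normr_gt0 => /(_ d0)[A _ Aw].
  have /= := Aw (e |` A)%fset (fsubsetU1 _ _).
  have -> : dot (x - w) e = dot (fourier_sum dot E x (e |` A)%fset - w) e.
    by rewrite !linearBl /= dot_fourier_sum// fset1U1.
  have e1 : `|e| = 1.
    by apply/eqP; rewrite -(@eqrXn2 _ 2)// dot_norm onE// eqxx expr1n.
  rewrite distrC => /lt_le_trans /(_ (norm_dot_le _ _)).
  by rewrite e1 mulr1 ltxx.
apply/(@cvgrPdist_lt _ R[i]^o) => eps eps0.
(* The error in Parseval's identity is the squared norm of the residual. *)
have /cvgrPdist_lt /(_ (sqrtC eps)) := cvgw.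
rewrite sqrtC_gt0 => /(_ eps0); apply: filterS => A.
rewrite -xw -dnorm_residual// -dot_norm normrX normr_id.
by rewrite -(@ltr_pXn2r _ 2)// ?nnegrE// ?sqrtC_ge0 ?ltW// sqrtCK.
Qed.

Lemma orthonormal_basis_exists : exists E, orthonormal_basis dot E.
Proof.
pose P := [set E : set H | forall e f, E e -> E f -> dot e f = (e == f)%:R].
have [|E [onE maxE]] := @Zorn_bigcup H P.
  move=> F FP totF e f [X FX Xe] [Y FY Yf].
  have [XY|YX] := totF _ _ FX FY; first by apply: (FP _ FY) => //; exact: XY.
  by apply: (FP _ FX) => //; exact: YX.
exists E; split=> // x xE; apply/eqP/negPn/negP => x0.
(* Adjoining the normalised [x] to [E] would contradict maximality. *)
pose u := `|x|^-1 *: x.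
have uu : dot u u = 1.
  by rewrite dnormZ -dot_norm normfV normr_id -exprMn mulVf ?normr_eq0// expr1n.
have uE e : E e -> dot u e = 0 by move=> Ee; rewrite linearZl_LR /= xE// mulr0.
have nEu : ~ E u by move=> /uE/eqP; rewrite uu oner_eq0.
have ue e : E e -> (u == e) = false by move=> Ee; apply/eqP => ue; rewrite ue in nEu.
apply: (maxE (E `|` [set u])).
  split; first exact: subsetUl.
  by move=> /(_ u (or_intror erefl)).
move=> e f [Ee|->] [Ef|->]; first exact: onE.
- by rewrite dotC uE// eq_sym ue// rmorph0.
- by rewrite uE// ue.
- by rewrite uu eqxx.
Qed.

(** * Uniqueness of the trace and its value for a rank one operator *)

Lemma has_trace_unique (T : H -> H) (a b : R[i]) :
  has_trace dot T a -> has_trace dot T b -> a = b.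
Proof.
(* With no basis at all, [has_trace] would hold vacuously of every number. *)
have [E basisE] := orthonormal_basis_exists.
move=> /(_ E basisE) ha /(_ E basisE) hb.
exact: (cvg_unique (@norm_hausdorff _ R[i]^o) ha hb).
Qed.

Lemma trace_eq (T : H -> H) (c : R[i]) : has_trace dot T c -> trace dot T = c.
Proof.
move=> Tc; apply: (has_trace_unique T) (Tc).
by apply: (@xgetPex _ 0 [set c | has_trace dot T c]); exists c.
Qed.

Lemma selfadjoint_rank_oneP (T : {linear H -> H}) :
  selfadjoint dot T -> rank_one T ->
  exists v : H, exists mu : R[i], [/\ v != 0, mu != 0, mu \is Num.real &
    forall x, T x = (mu * (dot x v / dot v v)) *: v].
Proof.
move=> saT [v v0 rangeT].
have Tv x : exists a, T x = a *: v.
  have : range T (T x) by exists x.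
  by rewrite rangeT => -[a _ <-]; exists a.
have vv0 : dot v v != 0 by rewrite dnorm_eq0.
have [mu Tmu] := Tv v.
have muR : Num.conj mu = mu.
  have := saT v v; rewrite Tmu linearZl_LR linearZr_LR /=.
  by move/(mulIf vv0).
(* Comparing [dot (T x) v] with [dot x (T v)] determines the coefficient of [T x] along [v]. *)
have TE x : T x = (mu * (dot x v / dot v v)) *: v.
  have [a Ta] := Tv x; have := saT x v.
  rewrite Ta Tmu linearZl_LR linearZr_LR /= muR => ax.
  by rewrite mulrA -ax mulfK.
exists v, mu; split=> //; last exact/CrealP.
(* If [mu = 0] then [T] vanishes, yet [v] lies in its range. *)
apply: contra_neq v0 => mu0.
have : range T v by rewrite rangeT; exists 1 => //; rewrite scale1r.
by move=> [x _ <-]; rewrite TE mu0 mul0r scale0r.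
Qed.

Lemma has_trace_rank_one (T : H -> H) (v : H) (mu : R[i]) : v != 0 ->
  (forall x, T x = (mu * (dot x v / dot v v)) *: v) -> has_trace dot T mu.
Proof.
move=> v0 TE E basisE.
have vv0 : dot v v != 0 by rewrite dnorm_eq0.
(* Each diagonal term is [mu / dot v v] times [|dot v e|^2], so Parseval's identity for [v] yields
   the limit [mu]. *)
have -> : partial_sum ((fun e => dot (T e) e) \_ E) =
    fun A => mu / dot v v * fourier_sqr dot E v A.
  apply/funext => A; rewrite /partial_sum /fourier_sqr mulr_sumr.
  rewrite [RHS]big_seq_fsetE; apply: eq_bigr => i _; move: (val i) => e.
  have [Ee|nEe] := pselect (E e).
    rewrite fourierE// patchE mem_set// TE linearZl_LR /= normCK.
    by rewrite -dotC -!mulrA [dot e v * _]mulrC -mulrA.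
  by rewrite fourier_out// patchE memNset// normr0 expr0n mulr0.
rewrite -[X in _ --> X](divfK vv0).
exact: cvgMr (parseval _ _ basisE).
Qed.

End HilbertSpace.

Theorem theorem3p10 (R : realType) (H : completeNormedModType R[i])
    (dot : {dot H for (@Num.conj R[i])}) (dot_norm : norm_from_dot dot)
    (T : {linear H -> H}) (T_bounded : bounded_operator T)
    (T_selfadjoint : selfadjoint dot T) (T_rank1 : rank_one T)
    (trT_neq0 : trace dot T <> 0) :
  simple_semigroup (generated_semigroup T) <->
  trace dot T = -1 \/ trace dot T = 1.
Proof.
have [v [mu [v0 mu0 muR TE]]] := selfadjoint_rank_oneP dot T T_selfadjoint T_rank1.
have trT : trace dot T = mu by apply: trace_eq => //; exact: has_trace_rank_one TE.
have vv0 : dot v v != 0 by rewrite dnorm_eq0.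
have Tv : T v = mu *: v by rewrite TE divff// mulr1.
rewrite trT; apply: generated_semigroup_simpleP => //.
  (* [T x] is a multiple of the eigenvector [v], hence [T (T x) = mu *: T x]. *)
  move=> x; rewrite [T x]TE; move: (_ * _) => c.
  by rewrite linearZ /= Tv !scalerA mulrC.
move=> /(congr1 (@^~ v)) /= /eqP.
by rewrite Tv scaler_eq0 (negbTE mu0) (negbTE v0).
Qed.
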